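(* Let $d\ge1$ and let $\{H_\omega\}_{\omega\in\Omega}$ be a family of ergodic self-adjoint operators on $\ell^2(\mathbb{Z}^d)$ over a probability space $(\Omega,\nu)$ with expectation $\mathbb{E}_\omega$. Let $I\subset\mathbb{C}$ and let $\rho(s,t,H_\omega)$, $s,t\in I$, be a family of operators on $\ell^2(\mathbb{Z}^d)$ such that for some constants $C,\mu\in(0,\infty)$ and all $x,y\in\mathbb{Z}^d$, $$\mathbb{E}_\omega\Big[\sup_{s,t\in I}|\langle\delta_x,\rho(s,t,H_\omega)\delta_y\rangle|\Big]\le C e^{-\mu|x-y|}.$$ Then for a.e. $\omega$ there is a constant $C_{\omega,d,\mu}>0$ such that for every $n\in\mathbb{N}$ and every pair of configurations $X=\{x_1,\dots,x_n\}\subset\mathbb{Z}^d$, $Y=\{y_1,\dots,y_n\}\subset\mathbb{Z}^d$, each consisting of distinct points and with (as is assumed without loss of generality) $\prod_{j=1}^n(1+|x_j|)\le\prod_{j=1}^n(1+|y_j|)$, $$\sup_{s,t\in I^n}\Big|\det\big(\langle\delta_{x_j},\rho(s_j,t_k,H_\omega)\delta_{y_k}\rangle\big)_{1\le j,k\le n}\Big|\le C_{\omega,d,\mu}^n\Big(\prod_{j=1}^n(1+|x_j|)^{d+1}\Big)e^{-\frac{\mu}{4\sqrt d}D_s(X,Y)}.$$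
   Context: Ergodic family: $(\Omega,\nu)$ is a probability measure space; $T_1,\dots,T_d$ are commuting ergodic (invertible, measure preserving) maps on $\Omega$ with respect to $\nu$; $\omega\mapsto H_\omega$ is a strongly measurable map from $\Omega$ to self-adjoint operators on $\ell^2(\mathbb{Z}^d)$; the family is ergodic if for each $x\in\mathbb{Z}^d$, $H_{T^x\omega}=U_xH_\omega U_x^{-1}$, where $T^x:=T_1^{x_1}\cdots T_d^{x_d}$ and $(U_x\phi)(y)=\phi(y-x)$. $\delta_x$ is the standard basis vector of $\ell^2(\mathbb{Z}^d)$ at $x$; $|\cdot|$ is the Euclidean norm; $s=(s_1,\dots,s_n)$, $t=(t_1,\dots,t_n)\in I^n$; $D_s(X,Y):=\min_{\pi\in S_n}\sum_{j=1}^n|x_j-y_{\pi(j)}|$, with $S_n$ the symmetric group. The constant $C_{\omega,d,\mu}$ does not depend on $n,X,Y,s,t$. *)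

(* Defs.v *)
From HB Require Import structures.
From mathcomp Require Import all_boot all_order all_algebra all_fingroup.
From mathcomp Require Import all_classical all_reals all_analysis measurable_realfun.
From mathcomp Require Import complex ring.
From mathcomp Require summability.

Set Implicit Arguments.
Unset Strict Implicit.
Unset Printing Implicit Defensive.

Import Order.TTheory GRing.Theory Num.Theory.
Import numFieldNormedType.Exports.
Import ComplexField.Normc.

Local Open Scope classical_set_scope.
Local Open Scope ring_scope.
Local Open Scope complex_scope.

Notation lattice d := 'rV[int]_d.

Definition enorm (R : realType) (d : nat) (x : lattice d) : R :=
  Num.sqrt (\sum_(i < d) (x 0 i)%:~R ^+ 2).

Section SquareSummable.
Context (R : realType) (d : nat).
Implicit Types (f g : lattice d -> R[i]).

Definition sqsum f : \bar R :=
  \esum_(x in [set: lattice d]) (normc (f x) ^+ 2)%:E.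

Definition square_summable : {pred lattice d -> R[i]} :=
  fun f => (sqsum f < +oo)%E.

Lemma normc_ge0 (z : R[i]) : 0 <= normc z.
Proof. by case: z => a b; exact: sqrtr_ge0. Qed.

Lemma le_normcD (z w : R[i]) : normc (z + w) <= normc z + normc w.
Proof. by rewrite -lecR rmorphD /=; exact: (ler_normD z w). Qed.

Lemma sqsum_ge0 f : (0 <= sqsum f)%E.
Proof. by apply: esum_ge0 => x _; rewrite lee_fin sqr_ge0. Qed.

Lemma sqsum_ge_term f x : ((normc (f x) ^+ 2)%:E <= sqsum f)%E.
Proof.
rewrite -(@esum_set1 _ _ x (fun x => (normc (f x) ^+ 2)%:E)) ?lee_fin ?sqr_ge0//.
rewrite /sqsum; apply: le_ereal_sup => _ [A [finA _] <-]; by exists A.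
Qed.

Lemma esumZ (T : choiceType) (c : R) (a : T -> R) :
  0 <= c -> (forall x, 0 <= a x) ->
  (\esum_(x in [set: T]) (c * a x)%:E = c%:E * \esum_(x in [set: T]) (a x)%:E)%E.
Proof.
move=> c0 a0; rewrite /esum -ereal_supZl//; last first.
  by apply/set0P; exists 0%E, set0; [exact: fsets_set0|rewrite fsbig_set0].
congr ereal_sup; rewrite eqEsubset; split=> [_ [A As <-]|_ [_ [A As <-] <-]].
  exists (\sum_(x \in A) (a x)%:E)%E; first by exists A.
  by rewrite ge0_mule_fsumr // => x; rewrite lee_fin.
by exists A => //; rewrite ge0_mule_fsumr // => x; rewrite lee_fin.
Qed.

Lemma sqsumZ a f : sqsum (a *: f) = ((normc a ^+ 2)%:E * sqsum f)%E.
Proof.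
rewrite /sqsum -esumZ ?sqr_ge0// => [|x]; last exact: sqr_ge0.
by apply: eq_esum => x _; rewrite normcM exprMn.
Qed.

Lemma sqsumD f g (t : R) : 0 < t ->
  (sqsum (f + g)%R <= (1 + t)%:E * sqsum f + (1 + t^-1)%:E * sqsum g)%E.
Proof.
move=> t0; have t1 : 0 <= 1 + t by rewrite addr_ge0 ?ltW.
have t'1 : 0 <= 1 + t^-1 by rewrite addr_ge0// invr_ge0 ltW.
rewrite /sqsum -!esumZ// => [|x|x]; rewrite ?sqr_ge0//.
rewrite -esumD => [|x _|x _]; try by rewrite lee_fin mulr_ge0// sqr_ge0.
apply: le_esum => x _; rewrite -EFinD lee_fin.
apply: (@le_trans _ _ ((normc (f x) + normc (g x)) ^+ 2)).
  by rewrite ler_pXn2r ?nnegrE ?addr_ge0 ?normc_ge0// le_normcD.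
rewrite -subr_ge0.
set p := normc (f x); set q := normc (g x).
suff -> : (1 + t) * p ^+ 2 + (1 + t^-1) * q ^+ 2 - (p + q) ^+ 2 =
          t * (p - t^-1 * q) ^+ 2 by rewrite mulr_ge0 ?sqr_ge0 ?ltW.
by field; rewrite gt_eqF.
Qed.

Fact square_summable_submod_closed : submod_closed square_summable.
Proof.
split=> [|a f g]; rewrite !unfold_in.
  rewrite /sqsum esum1 ?ltry// => x _ /=.
  by rewrite expr0n /= addr0 sqrtr0 expr0n.
move=> f2 g2; apply: le_lt_trans (sqsumD _ _ ltr01) _.
rewrite sqsumZ invr1 muleA -EFinM.
have n2_ge0 : 0 <= (1 + 1) * normc a ^+ 2 by rewrite mulr_ge0 ?addr_ge0 ?sqr_ge0.
by apply: lte_add_pinfty; apply: lte_mul_pinfty => //; rewrite lee_fin ?addr_ge0.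
Qed.

HB.instance Definition _ :=
  GRing.isSubmodClosed.Build _ _ square_summable square_summable_submod_closed.

End SquareSummable.

Section Ell2.
Context (R : realType) (d : nat).

Record ell2 := Ell2 {
  ell2_fun :> lattice d -> R[i];
  ell2_square_summable : ell2_fun \in @square_summable R d }.

HB.instance Definition _ := [isSub for ell2_fun].
HB.instance Definition _ := [Choice of ell2 by <:].
HB.instance Definition _ := [SubChoice_isSubLmodule of ell2 by <:].


Definition ell2_norm (phi : ell2) : R := Num.sqrt (fine (sqsum phi)).

Lemma sqsum_fin_num (phi : ell2) : sqsum phi \is a fin_num.
Proof. by rewrite ge0_fin_numE ?sqsum_ge0//; exact: ell2_square_summable. Qed.

Lemma sqsumE (phi : ell2) : sqsum phi = (ell2_norm phi ^+ 2)%:E.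
Proof.
by rewrite /ell2_norm sqr_sqrtr ?fine_ge0 ?sqsum_ge0// fineK// sqsum_fin_num.
Qed.

Lemma ell2_norm_ge0 (phi : ell2) : 0 <= ell2_norm phi.
Proof. exact: sqrtr_ge0. Qed.

Lemma ell2_norm0_eq0 (phi : ell2) : ell2_norm phi = 0 -> phi = 0.
Proof.
move=> phi0; apply/val_inj/funext => x /=; apply: eq0_normc.
have := sqsum_ge_term phi x; rewrite sqsumE phi0 expr0n lee_fin.
by move=> h; apply/eqP; rewrite -sqrf_eq0 eq_le h sqr_ge0.
Qed.

Lemma ell2_normZ (a : R[i]) (phi : ell2) :
  ell2_norm (a *: phi) = normc a * ell2_norm phi.
Proof.
apply/eqP; rewrite -(@eqrXn2 _ 2)// ?mulr_ge0 ?normc_ge0 ?ell2_norm_ge0//.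
by apply/eqP/EFin_inj; rewrite -sqsumE exprMn EFinM -sqsumE -sqsumZ.
Qed.

Lemma ell2_normD (phi psi : ell2) :
  ell2_norm (phi + psi) <= ell2_norm phi + ell2_norm psi.
Proof.
have [/ell2_norm0_eq0 ->|phi0] := eqVneq (ell2_norm phi) 0.
  by rewrite add0r lerDr ell2_norm_ge0.
have [/ell2_norm0_eq0 ->|psi0] := eqVneq (ell2_norm psi) 0.
  by rewrite addr0 lerDl ell2_norm_ge0.
have phi_gt0 : 0 < ell2_norm phi by rewrite lt_def phi0 ell2_norm_ge0.
have psi_gt0 : 0 < ell2_norm psi by rewrite lt_def psi0 ell2_norm_ge0.
rewrite -(@ler_pXn2r _ 2) ?nnegrE ?addr_ge0 ?ell2_norm_ge0//.
have := sqsumD phi psi (divr_gt0 psi_gt0 phi_gt0).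
rewrite -[sqsum (_ + _)%R]/(sqsum (phi + psi)%R) !sqsumE -!EFinM -EFinD lee_fin.
move/le_trans; apply; rewrite le_eqVlt; apply/orP; left; apply/eqP.
by field; rewrite phi0 psi0.
Qed.

Definition ell2_cnorm (phi : ell2) : R[i] := (ell2_norm phi)%:C.

Fact ell2_cnormD (phi psi : ell2) :
  ell2_cnorm (phi + psi) <= ell2_cnorm phi + ell2_cnorm psi.
Proof. by rewrite -rmorphD lecR ell2_normD. Qed.

Fact ell2_cnormZ (a : R[i]) (phi : ell2) :
  ell2_cnorm (a *: phi) = `|a| * ell2_cnorm phi.
Proof. by rewrite /ell2_cnorm ell2_normZ rmorphM. Qed.

Fact ell2_cnorm0_eq0 (phi : ell2) : ell2_cnorm phi = 0 -> phi = 0.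
Proof. by move=> /complexI /ell2_norm0_eq0. Qed.

HB.instance Definition _ :=
  Lmodule_isNormed.Build R[i] ell2 ell2_cnormD ell2_cnormZ ell2_cnorm0_eq0.

(* Unordered sum over the lattice, antilinear in the first argument. *)
Definition inner (phi psi : ell2) : R[i] :=
  summability.sum (fun x => conjc (phi x) * psi x : R[i]^o).

Fact delta_square_summable (x : lattice d) :
  (fun y => (y == x)%:R) \in @square_summable R d.
Proof.
rewrite unfold_in /sqsum (esumID [set x])//; last by move=> y _; rewrite lee_fin sqr_ge0.
rewrite !setTI esum_set1 ?lee_fin ?sqr_ge0// esum1 ?adde0 ?ltry//.
by move=> y /= /eqP/negbTE ->; rewrite normc0 expr0n.
Qed.

Definition delta (x : lattice d) : ell2 := Ell2 (delta_square_summable x).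

Fact translate_square_summable (x : lattice d) (phi : ell2) :
  (fun y => phi (y - x)) \in @square_summable R d.
Proof.
rewrite unfold_in; suff -> : sqsum (fun y => phi (y - x)) = sqsum phi.
  exact: ell2_square_summable.
rewrite /sqsum; apply: esym.
rewrite (@reindex_esum _ _ _ setT setT (fun y : lattice d => y - x))//.
by split=> // [y z _ _ /addIr //|y _]; exists (y + x); rewrite ?addrK.
Qed.

Definition translate (x : lattice d) (phi : ell2) : ell2 :=
  Ell2 (translate_square_summable x phi).


Fact translate_is_linear (x : lattice d) : linear (translate x).
Proof. by move=> a phi psi; exact/val_inj. Qed.

HB.instance Definition _ (x : lattice d) :=
  GRing.isLinear.Build R[i] ell2 ell2 _ (translate x) (translate_is_linear x).

End Ell2.

Section Operators.
Context (R : realType) (d : nat).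
Local Notation ell2 := (ell2 R d).

(* A possibly unbounded linear operator.  The field [op_act] is total; requiring
   it to vanish off the domain makes equality of records the usual equality of
   operators (same domain, same values on it). *)
Record operator := Operator {
  op_dom : set ell2;
  op_act :> ell2 -> ell2;
  op_dom0 : op_dom 0;
  op_dom_linear : forall (a : R[i]) phi psi,
    op_dom phi -> op_dom psi -> op_dom (a *: phi + psi);
  op_linear : forall (a : R[i]) phi psi,
    op_dom phi -> op_dom psi ->
    op_act (a *: phi + psi) = a *: op_act phi + op_act psi;
  op_act_out : forall phi, ~ op_dom phi -> op_act phi = 0 }.

Definition graph (A : operator) : set (ell2 * ell2) :=
  [set p | op_dom A p.1 /\ A p.1 = p.2].

Definition adjoint_graph (A : operator) : set (ell2 * ell2) :=
  [set p | forall psi, op_dom A psi -> inner p.1 (A psi) = inner p.2 psi].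

Record self_adjoint_operator := SelfAdjoint {
  sa_operator :> operator;
  sa_dense : dense (op_dom sa_operator);
  sa_adjoint : adjoint_graph sa_operator = graph sa_operator }.

Section Conjugate.
Context (x : lattice d) (A : operator).

Let cdom : set ell2 := [set phi | op_dom A (translate (- x) phi)].
Let cact (phi : ell2) : ell2 := translate x (A (translate (- x) phi)).

Fact conjugate_dom0 : cdom 0.
Proof. by rewrite /cdom /= linear0; exact: op_dom0. Qed.

Fact conjugate_dom_linear (a : R[i]) phi psi :
  cdom phi -> cdom psi -> cdom (a *: phi + psi).
Proof. by rewrite /cdom /= linearP; exact: op_dom_linear. Qed.

Fact conjugate_act_linear (a : R[i]) phi psi :
  cdom phi -> cdom psi -> cact (a *: phi + psi) = a *: cact phi + cact psi.
Proof. by move=> ? ?; rewrite /cact linearP op_linear// linearP. Qed.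

Fact conjugate_act_out phi : ~ cdom phi -> cact phi = 0.
Proof. by move=> ?; rewrite /cact op_act_out// linear0. Qed.

(* U_x A U_x^{-1}, where U_x^{-1} = U_{-x}. *)
Definition conjugate : operator :=
  Operator conjugate_dom0 conjugate_dom_linear conjugate_act_linear
    conjugate_act_out.

End Conjugate.

(* The value at phi of (A - z)^{-1}, for non-real z and self-adjoint A. *)
Definition resolvent (A : operator) (z : R[i]) (phi : ell2) : ell2 :=
  xget 0 [set psi | op_dom A psi /\ A psi - z *: psi = phi].

Definition matrix_element (A : operator) (x y : lattice d) : R[i] :=
  inner (delta R x) (A (delta R y)).

End Operators.

Section ErgodicFamily.
Context (R : realType) (disp : measure_display) (Omega : measurableType disp).
Context (nu : probability Omega R).

Record mp_automorphism := MPAutomorphism {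
  mp_fun :> Omega -> Omega;
  mp_inv : Omega -> Omega;
  mp_funK : cancel mp_fun mp_inv;
  mp_invK : cancel mp_inv mp_fun;
  measurable_mp_fun : measurable_fun setT mp_fun;
  measurable_mp_inv : measurable_fun setT mp_inv;
  mp_preserving : forall A, measurable A -> nu (mp_fun @^-1` A) = nu A }.

Definition ergodic (T : mp_automorphism) : Prop :=
  forall A, measurable A -> T @^-1` A = A -> nu A = 0%E \/ nu A = 1%E.

Definition zpow (T : mp_automorphism) (m : int) : Omega -> Omega :=
  match m with
  | Posz n => iter n T
  | Negz n => iter n.+1 (mp_inv T)
  end.

Context (d : nat).

Definition lattice_action (T : 'I_d -> mp_automorphism) (x : lattice d) :
    Omega -> Omega :=
  \big[(fun f g => f \o g)/idfun]_(i < d) zpow (T i) (x 0 i).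

(* For unbounded operators measurability is expressed through the resolvents;
   ell2 carries the Borel sigma-algebra of its norm. *)
Definition strongly_measurable (H : Omega -> self_adjoint_operator R d) : Prop :=
  forall (z : R[i]) (phi : ell2 R d), Im z != 0 ->
    measurable_fun setT
      (fun w => resolvent (H w) z phi : g_sigma_algebraType (@open (ell2 R d))).

Record ergodic_family (T : 'I_d -> mp_automorphism)
    (H : Omega -> self_adjoint_operator R d) : Prop := ErgodicFamily {
  ergodic_commute : forall i j w, T i (T j w) = T j (T i w);
  ergodic_ergodic : forall i, ergodic (T i);
  ergodic_measurable : strongly_measurable H;
  ergodic_covariant : forall x w,
    sa_operator (H (lattice_action T x w)) = conjugate x (H w) }.

End ErgodicFamily.

Section Matching.
Context (R : realType) (d n : nat).

Definition matching_cost (X Y : 'I_n -> lattice d) (s : 'S_n) : R :=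
  \sum_(j < n) enorm R (X j - Y (s j)).

(* The unit of the iterated minimum is itself one of the costs. *)
Definition matching_dist (X Y : 'I_n -> lattice d) : R :=
  \big[Num.min/matching_cost X Y 1%g]_(s : 'S_n) matching_cost X Y s.

End Matching.

(* Main.v *)
(** With [mu' = mu / (4 sqrt d) < mu], the decay hypothesis and Tonelli give a
    finite expectation to the double series over [x, y] of
    [(1 + |x|)^-(d+1) e^(mu' |x - y|) M(x, y)], where [M(x, y)] is the supremum
    of the matrix elements; its sum [S] is therefore finite almost surely.
    In the Leibniz expansion of the determinant a factor [e^(-mu' D(X, Y))] can
    be extracted from every permutation, and the remaining sum over permutations
    is at most [\prod_j \sum_k M(x_j, y_k) e^(mu' |x_j - y_k|)]
    [<= \prod_j S (1 + |x_j|)^(d+1)], because the [y_k] are distinct. *)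

Require Import Defs.
From mathcomp Require Import all_boot all_order all_algebra perm.
From mathcomp Require Import all_classical all_reals all_analysis measurable_realfun.
From mathcomp Require Import complex zify ring.

Import Order.TTheory GRing.Theory Num.Theory.
Import numFieldNormedType.Exports.
Import ComplexField.Normc.

Local Open Scope classical_set_scope.
Local Open Scope ring_scope.
Local Open Scope complex_scope.

Set Implicit Arguments.
Unset Strict Implicit.

(** * Determinants, permutations and matchings *)

Lemma norm_det_le (K : numDomainType) n (A : 'M[K]_n) :
  `|\det A| <= \sum_(s : 'S_n) \prod_i `|A i (s i)|.
Proof.
apply: le_trans (ler_norm_sum _ _ _) _; apply: ler_sum => s _.
by rewrite normrMsign normr_prod.
Qed.

(** Expanding the right-hand side gives one term for each self-map of ['I_n]; the injective maps
    give the left-hand side, and the other terms are nonnegative. *)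
Lemma sum_perm_prod_le (K : numDomainType) n (b : 'I_n -> 'I_n -> K) :
  (forall i j, 0 <= b i j) ->
  \sum_(s : 'S_n) \prod_i b i (s i) <= \prod_i \sum_j b i j.
Proof.
move=> b0; rewrite bigA_distr_bigA /=.
rewrite (bigID (fun f : {ffun 'I_n -> 'I_n} => injectiveb f)) /=.
rewrite (reindex (@pval _)) /=; last first.
  exists (insubd (1%g : 'S_n)) => /= f Uf; first exact: val_inj (insubdK _ _).
  exact: insubdK.
rewrite [X in _ <= X + _](_ : _ = \sum_(s : 'S_n) \prod_i b i (s i)).
  by rewrite lerDl sumr_ge0// => f _; exact: prodr_ge0.
by apply: eq_big => [s|s _]; [rewrite (valP s)|rewrite pvalE].
Qed.

Lemma normc_det_le (R : realType) n (A : 'M[R[i]]_n) :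
  normc (\det A) <= \sum_(s : 'S_n) \prod_i normc (A i (s i)).
Proof.
rewrite -lecR rmorph_sum; apply: le_trans (norm_det_le A) _.
by apply: ler_sum => s _; rewrite rmorph_prod.
Qed.

(** Each permutation costs at least [matching_dist], so multiplying its Leibniz term by
    [expR (c * matching_dist R X Y)] is dominated by attaching the weight
    [expR (c * enorm R (X j - Y k))] to each entry used. *)
Lemma normc_det_le_matching (R : realType) (d n : nat) (A : 'M[R[i]]_n)
    (X Y : 'I_n -> lattice d) (c : R) (B : 'I_n -> R) : 0 <= c ->
  (forall j, \sum_k normc (A j k) * expR (c * enorm R (X j - Y k)) <= B j) ->
  normc (\det A) <= \prod_j B j * expR (- (c * matching_dist R X Y)).
Proof.
move=> c0 AB; rewrite expRN ler_pdivlMr ?expR_gt0//.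
apply: le_trans (ler_wpM2r (expR_ge0 _) (normc_det_le A)) _.
pose b j k := normc (A j k) * expR (c * enorm R (X j - Y k)).
have b0 j k : 0 <= b j k by rewrite mulr_ge0 ?normc_ge0 ?expR_ge0.
apply: (@le_trans _ _ (\prod_j \sum_k b j k)); last first.
  by apply: ler_prod => j _; rewrite AB andbT sumr_ge0.
apply: le_trans (sum_perm_prod_le b0); rewrite mulr_suml; apply: ler_sum => s _.
rewrite big_split /= ler_wpM2l//.
  by apply: prodr_ge0 => i _; exact: normc_ge0.
rewrite -expR_sum ler_expR -mulr_sumr ler_wpM2l//.
exact: (bigmin_le _ s (matching_cost R X Y)).
Qed.

(** * Unordered sums and almost sure finiteness *)

Lemma sum_le_esum (R : realType) (I : finType) (T : choiceType) (f : I -> T)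
    (a : T -> \bar R) : injective f -> (forall t, 0 <= a t)%E ->
  (\sum_i a (f i) <= \esum_(t in [set: T]) a t)%E.
Proof.
move=> finj a0; apply: esum_ge; exists (range f).
  by split=> //; exact: finite_image.
rewrite fsbig_image => [|x y _ _ /finj//].
rewrite [setT](_ : _ = [set` index_enum I]).
  by rewrite -fsbig_seq// index_enum_uniq.
by apply/seteqP; split=> // x _; exact: mem_index_enum.
Qed.

(** By Tonelli the sum has finite integral, and an integrable function is finite almost everywhere.
    Countability of [T] turns the unordered sum into a series over [nat]. *)
Lemma ae_esum_lty (R : realType) (disp : measure_display)
    (Omega : measurableType disp) (nu : probability Omega R) (T : countType)
    (f : T -> Omega -> \bar R) :
  (forall t, measurable_fun setT (f t)) -> (forall t w, 0 <= f t w)%E ->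
  (\esum_(t in [set: T]) \int[nu]_w f t w < +oo)%E ->
  {ae nu, forall w, (\esum_(t in [set: T]) f t w < +oo)%E}.
Proof.
move=> mf f0 foo.
(* Indices that are not the code of an element of [T] contribute 0. *)
pose g n w := oapp (f^~ w) 0%E (pickle_inv n : option T).
have g0 n w : (0 <= g n w)%E by rewrite /g; case: pickle_inv => /=.
have mg n : measurable_fun setT (g n).
  by rewrite /g; case: pickle_inv => [t|] /=; [exact: mf|exact: measurable_cst].
have gE (a : T -> \bar R) : (forall t, 0 <= a t)%E ->
    (\sum_(n <oo) oapp a 0%E (pickle_inv n) = \esum_(t in [set: T]) a t)%E.
  move=> a0; rewrite nneseries_esumT; last by move=> n; case: pickle_inv => /=.
  rewrite (esumID (range (@pickle T))); last by move=> n _; case: pickle_inv => /=.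
  rewrite setTI [X in (_ + X)%E]esum1 ?adde0 => [|n [_ nr]]; last first.
    case E : pickle_inv => [t|]//=; exfalso; apply: nr; exists t => //.
    by have := @pickle_invK T n; rewrite E.
  rewrite esum_image; last by move=> x y _ _ /(pcan_inj pickleK_inv).
  by apply: eq_esum => t _; rewrite pickleK_inv.
have gint : (\int[nu]_w \sum_(n <oo) g n w < +oo)%E.
  rewrite integral_nneseries// (eq_eseriesr (g := fun n =>
      oapp (fun t => \int[nu]_w f t w)%E 0%E (pickle_inv n))).
    by rewrite gE// => t; exact: integral_ge0.
  by move=> n _; rewrite /g; case: pickle_inv => //=; rewrite integral0.
have mS : measurable_fun setT (fun w => \sum_(n <oo) g n w)%E.
  exact: ge0_emeasurable_sum.
have S0 w : (0 <= \sum_(n <oo) g n w)%E by exact: nneseries_ge0.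
have : nu.-integrable setT (fun w => \sum_(n <oo) g n w)%E.
  apply/integrableP; split=> //.
  by under eq_integral do rewrite gee0_abs//.
move=> /(integrable_ae measurableT); apply: filterS => w /(_ Logic.I).
by rewrite ge0_fin_numE// gE.
Qed.

(** Only a covering is asked of [g]: a point reached several times is counted several times, which
    can only enlarge the bound. *)
Lemma esum_le_cover (R : realType) (J : finType) (T : choiceType) (g : J -> T)
    (D : set T) (a : T -> \bar R) (c : R) : 0 <= c -> D `<=` range g ->
  (forall x, D x -> (a x <= c%:E)%E) ->
  (\esum_(x in D) a x <= (#|J|%:R * c)%:E)%E.
Proof.
move=> c0 Dg ac; pose h x j : \bar R := if x == g j then c%:E else 0%E.
have h0 x j : (0 <= h x j)%E by rewrite /h; case: ifP.
apply: (@le_trans _ _ (\esum_(x in [set: T]) \sum_j h x j)%E).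
  rewrite esum_mkcond; apply: le_esum => x _.
  case: ifPn => [|_]; last exact: sume_ge0.
  rewrite inE => Dx; have [j _ gj] := Dg _ Dx.
  apply: (le_trans (ac _ Dx)); rewrite (bigD1 j)//= {1}/h gj eqxx.
  by rewrite leeDl// sume_ge0.
rewrite esum_sum//; apply: (@le_trans _ _ (\sum_(j : J) c%:E)%E); last first.
  by rewrite sumEFin lee_fin sumr_const mulr_natl.
apply: lee_sum => j _; rewrite (esumID [set g j])// setTI esum_set1//.
rewrite esum1 ?adde0 => [|x [_ /eqP/negbTE xg]]; first by rewrite /h eqxx.
by rewrite /h xg.
Qed.

(** * Convergence of polynomial and exponential sums over the lattice *)

Section LatticeSums.
Variables (R : realType) (d : nat).
Implicit Types x : lattice d.

Lemma enorm_ge0 x : 0 <= enorm R x.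
Proof. exact: sqrtr_ge0. Qed.

Definition max_absz x : nat := \max_(i < d) `|x 0%R i|%N.

Lemma max_absz_le_enorm x : (max_absz x)%:R <= enorm R x.
Proof.
apply: (big_ind (fun n => n%:R <= enorm R x)); first exact: enorm_ge0.
  by move=> m n hm hn; rewrite /maxn; case: ifP.
move=> i _; rewrite natr_absz intr_norm -sqrtr_sqr.
rewrite ler_wsqrtr// (bigD1 i)//= lerDl sumr_ge0// => j _; exact: sqr_ge0.
Qed.

(** The successor puts the origin into shell 0, so that the shells partition the whole lattice. *)
Definition dyadic_shell k : set (lattice d) :=
  [set x | trunc_log 2 (max_absz x).+1 = k].

(* The shell lies in a cube of [(4 * 2 ^ k) ^ d] points, and each of its points
   has weight at most [(2 ^ k) ^- d.+1]. *)
Lemma esum_dyadic_shell k :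
  (\esum_(x in dyadic_shell k) ((1 + enorm R x) ^- d.+1)%:E
   <= (4 ^+ d / 2 ^+ k)%:E)%E.
Proof.
pose J := {ffun 'I_d -> 'I_(2 ^ k.+2)%N}.
(* The shift makes each coordinate range from [- 2 ^ k.+1] to [2 ^ k.+1 - 1], which covers the
   shell. *)
pose g (f : J) : lattice d := \row_i ((f i : nat)%:Z - (2 ^ k.+1)%N%:Z).
have shellP x : dyadic_shell k x ->
    (2 ^ k <= (max_absz x).+1 < 2 ^ k.+1)%N.
  by move=> <-; apply: trunc_log_bounds.
have -> : 4 ^+ d / 2 ^+ k = #|J|%:R * (2 ^+ k) ^- d.+1 :> R.
  have u0 : (2 ^+ k : R) != 0 by rewrite expf_neq0.
  rewrite card_ffun !card_ord !natrX 2!exprS mulrA -natrM exprMn [in RHS]exprS.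
  by field; rewrite u0 expf_neq0.
apply: (@esum_le_cover _ _ _ g) => [|x /shellP /andP[_ xk]|x /shellP /andP[kx _]].
- by rewrite invr_ge0 !exprn_ge0.
- have xi (i : 'I_d) : (`|x 0%R i| < 2 ^ k.+1)%N.
    apply: leq_ltn_trans (ltnW xk); exact: (leq_bigmax i).
  have hi (i : 'I_d) : (`|(x 0 i + (2 ^ k.+1)%N%:Z)%R| < 2 ^ k.+2)%N.
    by rewrite (expnS 2 k.+1); have := xi i; lia.
  exists [ffun i => Ordinal (hi i)] => //.
  apply/rowP => i; rewrite mxE ffunE /=; move: (xi i).
  by move: (x 0 i : int) (2 ^ k.+1)%N => z N; lia.
- rewrite lee_fin lef_pV2 ?posrE ?exprn_gt0// ?ltr_pwDl ?enorm_ge0//.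
  rewrite lerXn2r ?nnegrE ?exprn_ge0 ?addr_ge0 ?enorm_ge0//.
  apply: (@le_trans _ _ (max_absz x).+1%:R); first by rewrite -natrX ler_nat.
  by rewrite -addn1 natrD addrC lerD2l max_absz_le_enorm.
Qed.

(** The exponent exceeds the dimension by one, which leaves a factor [2 ^- k] on the [k]-th shell
    and hence a geometric series. *)
Lemma esum_enorm_pow_lty :
  (\esum_(x in [set: lattice d]) ((1 + enorm R x) ^- d.+1)%:E < +oo)%E.
Proof.
have w0 x : (0 <= ((1 + enorm R x) ^- d.+1)%:E)%E.
  by rewrite lee_fin invr_ge0 exprn_ge0// addr_ge0// enorm_ge0.
have -> : [set: lattice d] = \bigcup_k dyadic_shell k.
  by apply/seteqP; split=> // x _; exists (trunc_log 2 (max_absz x).+1).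
rewrite nneseries_sum_bigcup//; last first.
  by move=> i j _ _ [x [<- <-]].
(* The exponents of the reference geometric series start at one, whence the factor 2. *)
apply: le_lt_trans (ltry (2 * 4 ^+ d)).
rewrite -[X in (_ <= X%:E)%E]divr1 -(expr0 (2 : R)).
rewrite -(cvg_lim _ (@cvg_geometric_eseries_half R (2 * 4 ^+ d) 0))//.
apply: lee_nneseries => [k _ _|k _]; first exact: esum_ge0.
apply: le_trans (esum_dyadic_shell k) _; rewrite lee_fin addn1 natrX exprS.
by rewrite invfM mulrACA mulfV// mul1r.
Qed.

(** With [a = c / n.+1%:R], the exponential is the [n.+1]-st power of [expR (a * r)], and [expR (a *
    r) >= 1 + a * r >= Num.min 1 a * (1 + r)]. *)
Lemma expR_ge_pow (c r : R) n : 0 < c -> 0 <= r ->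
  (Num.min 1 (c / n.+1%:R)) ^+ n.+1 * (1 + r) ^+ n.+1 <= expR (c * r).
Proof.
move=> c0 r0; set m := Num.min _ _.
have m0 : 0 < m by rewrite lt_min ltr01 divr_gt0.
have -> : c * r = n.+1%:R * (c / n.+1%:R * r).
  by rewrite mulrA mulrCA mulfV ?mulr1// pnatr_eq0.
rewrite expRM_natl -exprMn lerXn2r ?nnegrE ?expR_ge0//.
  by rewrite mulr_ge0 ?addr_ge0// ltW.
apply: le_trans (expR_ge1Dx _); rewrite mulrDr mulr1 lerD ?ge_min ?lexx//.
by rewrite ler_wpM2r// ge_min lexx orbT.
Qed.

Lemma esum_expR_enorm_lty (c : R) : 0 < c ->
  (\esum_(x in [set: lattice d]) (expR (- (c * enorm R x)))%:E < +oo)%E.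
Proof.
move=> c0; pose m := Num.min 1 (c / d.+1%:R).
have m0 : 0 < m by rewrite lt_min ltr01 divr_gt0.
have wp x : 0 < 1 + enorm R x by rewrite ltr_pwDl ?enorm_ge0.
apply: (@le_lt_trans _ _ (\esum_(x in [set: lattice d])
    (m ^- d.+1 * (1 + enorm R x) ^- d.+1)%:E)%E).
  apply: le_esum => x _; rewrite lee_fin expRN -invfM lef_pV2 ?posrE ?expR_gt0//.
    exact: expR_ge_pow (enorm_ge0 x).
  by rewrite mulr_gt0 ?exprn_gt0.
rewrite esumZ ?lte_mul_pinfty ?lee_fin ?invr_ge0 ?exprn_ge0 ?ltW//.
  exact: esum_enorm_pow_lty.
by move=> x; rewrite invr_ge0 exprn_ge0// ltW.
Qed.

End LatticeSums.

(** Substituting [z = x - y] in the inner sum gives a constant [K] independent of [x], so the double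
    sum factors. *)
Lemma esum_lattice_kernel_lty (R : realType) (d : nat) (c : R) : 0 < c ->
  (\esum_(p in [set: lattice d * lattice d])
     ((1 + enorm R p.1) ^- d.+1 * expR (- (c * enorm R (p.1 - p.2))))%:E
   < +oo)%E.
Proof.
move=> c0; pose W x : R := (1 + enorm R (x : lattice d)) ^- d.+1.
have W0 x : 0 <= W x by rewrite invr_ge0 exprn_ge0// addr_ge0// enorm_ge0.
pose e (z : lattice d) := expR (- (c * enorm R z)).
have -> : [set: lattice d * lattice d] = [set: lattice d] `*`` fun=> setT.
  by apply/seteqP; split.
rewrite -(esum_esum (a := fun x y => (W x * e (x - y))%:E)); last first.
  by move=> x y _ _; rewrite lee_fin mulr_ge0// expR_ge0.
pose K := (\esum_(z in [set: lattice d]) (e z)%:E)%E.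
have KE x : (\esum_(y in [set: lattice d]) (W x * e (x - y))%:E =
    (W x)%:E * K)%E.
  rewrite esumZ// => [|y]; last exact: expR_ge0.
  congr (_ * _)%E; apply/esym/reindex_esum.
  split=> // [y z _ _ /addrI /oppr_inj //|z _].
  by exists (x - z); rewrite ?subKr.
have K0 : (0 <= K)%E by apply: esum_ge0 => z _; rewrite lee_fin expR_ge0.
have Kfin : K \is a fin_num by rewrite ge0_fin_numE// esum_expR_enorm_lty.
under eq_esum do rewrite KE -(fineK Kfin) muleC.
rewrite esumZ ?fine_ge0//.
by apply: lte_mul_pinfty; rewrite ?lee_fin ?fine_ge0 ?esum_enorm_pow_lty.
Qed.

(** * Almost sure summability of the weighted suprema and the determinant bound *)

Unset Implicit Arguments.

Theorem theorem3p2 (R : realType) (d : nat) (hd : (1 <= d)%N)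
    (disp : measure_display) (Omega : measurableType disp)
    (nu : probability Omega R)
    (T : 'I_d -> mp_automorphism nu)
    (H : Omega -> self_adjoint_operator R d)
    (hH : ergodic_family T H)
    (I : set R[i])
    (rho : R[i] -> R[i] -> self_adjoint_operator R d -> operator R d)
    (hdom : forall s t w y, I s -> I t -> op_dom (rho s t (H w)) (delta R y))
    (C mu : R) (hC : 0 < C) (hmu : 0 < mu)
    (hmeas : forall x y : lattice d, measurable_fun [set: Omega] (fun w =>
       ereal_sup [set (normc (matrix_element (rho s t (H w)) x y))%:E
                 | s in I & t in I]))
    (hdecay : forall x y : lattice d,
       (\int[nu]_w ereal_sup
          [set (normc (matrix_element (rho s t (H w)) x y))%:E
          | s in I & t in I]
        <= (C * expR (- (mu * enorm R (x - y))))%:E)%E) :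
  {ae nu, forall w, exists2 Cw : R, 0 < Cw &
    forall (n : nat) (X Y : 'I_n -> lattice d),
      injective X -> injective Y ->
      \prod_(j < n) (1 + enorm R (X j)) <= \prod_(j < n) (1 + enorm R (Y j)) ->
      (ereal_sup
         [set (normc (\det (\matrix_(j < n, k < n)
                 matrix_element (rho (s j) (t k) (H w)) (X j) (Y k))))%:E
         | s in [set s : 'I_n -> R[i] | forall j, I (s j)]
         & t in [set t : 'I_n -> R[i] | forall j, I (t j)]]
       <= (Cw ^+ n * (\prod_(j < n) (1 + enorm R (X j)) ^+ d.+1)
           * expR (- (mu / (4 * Num.sqrt d%:R) * matching_dist R X Y)))%:E)%E}.
Proof.
pose M x y w := ereal_sup [set (normc (matrix_element (rho s t (H w)) x y))%:E
  | s in I & t in I].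
(* Here [hd] enters: it gives [c <= mu / 4], so that [mu - c] is positive. *)
have sqd : 1 <= Num.sqrt (d%:R : R).
  by rewrite -[leLHS]sqrtr1 ler_wsqrtr// ler1n.
have q0 : 0 < 4 * Num.sqrt (d%:R : R) by rewrite mulr_gt0// (lt_le_trans ltr01).
pose c := mu / (4 * Num.sqrt d%:R).
have c0 : 0 < c by rewrite divr_gt0.
have cmu : 0 < mu - c.
  rewrite subr_gt0 ltr_pdivrMr// ltr_pMr//.
  by apply: lt_le_trans (ler_wpM2l _ sqd) => //; rewrite mulr1 ltr1n.
(* If [I] is empty the supremum is [-oo], hence the truncation at 0. *)
have intM x y : (\int[nu]_w maxe (M x y w) 0%E <=
    (C * expR (- (mu * enorm R (x - y))))%:E)%E.
  have [[s Is]|I0] := pselect (I !=set0).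
    apply: le_trans (hdecay x y); rewrite le_eqVlt; apply/orP; left; apply/eqP.
    apply: eq_integral => w _; apply: max_l.
    apply: (@le_trans _ _ (normc (matrix_element (rho s s (H w)) x y))%:E).
      by rewrite lee_fin normc_ge0.
    by apply: ereal_sup_ubound; exists s => //; exists s.
  rewrite integral0_eq => [|w _].
    by rewrite lee_fin mulr_ge0 ?expR_ge0// ltW.
  rewrite /M (_ : [set _ | _ in _ & _ in _] = set0) ?ereal_sup0 ?maxNye//.
  by apply/seteqP; split=> // z [s Is]; case: I0; exists s.
pose W (p : lattice d * lattice d) : R :=
  (1 + enorm R p.1) ^- d.+1 * expR (c * enorm R (p.1 - p.2)).
have W0 p : 0 <= W p.
  by rewrite mulr_ge0 ?expR_ge0// invr_ge0 exprn_ge0// addr_ge0// enorm_ge0.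
pose f p w := ((W p)%:E * maxe (M p.1 p.2 w) 0)%E.
have f0 p w : (0 <= f p w)%E by rewrite mule_ge0 ?lee_fin// le_max lexx orbT.
have mM x y : measurable_fun setT (fun w => maxe (M x y w) 0%E).
  by apply: measurable_maxe; [exact: hmeas|exact: measurable_cst].
have mf p : measurable_fun setT (f p) by exact: measurable_funeM.
have foo : (\esum_(p in [set: lattice d * lattice d]) \int[nu]_w f p w < +oo)%E.
  (* The exponential weight in [W] uses up the rate [c], and the remaining decay at rate [mu - c]
     makes the sum over the second point converge. *)
  apply: (@le_lt_trans _ _ (\esum_(p in [set: lattice d * lattice d])
    (C * ((1 + enorm R p.1) ^- d.+1 *
       expR (- ((mu - c) * enorm R (p.1 - p.2)))))%:E)%E).
    apply: le_esum => -[x y] _; rewrite ge0_integralZl//; last 2 first.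
    - by move=> w _; rewrite le_max lexx orbT.
    - exact: W0.
    apply: (le_trans (lee_wpmul2l _ (intM x y))); first exact: W0.
    rewrite -EFinM lee_fin /W /= le_eqVlt; apply/orP; left; apply/eqP.
    rewrite mulrBl opprB expRD; ring.
  rewrite esumZ ?(ltW hC)// => [|p]; last first.
    by rewrite mulr_ge0 ?expR_ge0// invr_ge0 exprn_ge0// addr_ge0// enorm_ge0.
  by apply: lte_mul_pinfty; rewrite ?lee_fin ?ltW// esum_lattice_kernel_lty.
have := ae_esum_lty mf f0 foo; apply: filterS => w Sw.
pose S := (\esum_(p in [set: lattice d * lattice d]) f p w)%E.
have S0 : (0 <= S)%E by exact: esum_ge0.
have SE : S = (fine S)%:E by rewrite fineK// ge0_fin_numE.
(* Adding 1 keeps the constant positive when [S] vanishes. *)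
exists (fine S + 1); first by rewrite ltr_wpDl// fine_ge0.
move=> n X Y _ Yinj _; apply: ge_ereal_sup => _ [s Is [t It <-]].
rewrite lee_fin.
have -> : (fine S + 1) ^+ n * \prod_(j < n) (1 + enorm R (X j)) ^+ d.+1 =
    \prod_(j < n) ((fine S + 1) * (1 + enorm R (X j)) ^+ d.+1).
  by rewrite big_split /= prodr_const card_ord.
apply: normc_det_le_matching => [|j]; first exact: ltW.
have Xj0 : 0 < (1 + enorm R (X j)) ^+ d.+1.
  by rewrite exprn_gt0// ltr_pwDl// enorm_ge0.
(* After division by the polynomial factor, the row sum is bounded by the part of [S] over the pairs
   [(X j, Y k)], which are distinct since [Y] is injective. *)
rewrite -ler_pdivrMr// -lee_fin; apply: (@le_trans _ _ S); last first.
  by rewrite SE lee_fin lerDl.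
apply: le_trans (sum_le_esum (f := fun k => (X j, Y k)) _ (f0^~ w)); last first.
  by move=> k l [/Yinj].
rewrite mulr_suml -sumEFin; apply: lee_sum => k _.
rewrite mxE /f /W /=.
rewrite [X in (X%:E <= _)%E](_ : _ = (1 + enorm R (X j)) ^- d.+1 *
  expR (c * enorm R (X j - Y k)) *
  normc (matrix_element (rho (s j) (t k) (H w)) (X j) (Y k))); last by ring.
rewrite EFinM; apply: lee_wpmul2l; first exact: (W0 (X j, Y k)).
rewrite le_max; apply/orP; left; apply: ereal_sup_ubound.
by exists (s j) => //; exists (t k).
Qed.
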